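(* Every Matet-adequate family $\mathcal H\subseteq\mathrm{FIN}^\infty$ is a selective coideal in $\mathrm{FIN}^\infty$. Therefore, Matet-adequate families and selective coideals in $\mathrm{FIN}^\infty$ coincide.
   Context: Here $k=1$: $\mathrm{FIN}=\mathrm{FIN}_1$ is the set of nonempty finite subsets of $\mathbb N$ (identified with their characteristic functions). For $s,t\in\mathrm{FIN}$, $s<t$ means $\max s<\min t$. $\mathrm{FIN}^\infty$ is the set of infinite block sequences $A=(s_n)$ ($s_n<s_{n+1}$), $\mathrm{FIN}^{<\infty}$ the set of finite ones. For a block sequence $A$, $[A]=FU(A)$ is the set of finite nonempty unions of elements of $A$. $X\le Y$ means every element of $X$ is in $[Y]$; $X\le^* Y$ means all but finitely many elements of $X$ are in $[Y]$. $r_n(A)$ is the sequence of the first $n$ elements of $A$; $|a|$ is the length of $a$. $[a,A]=\{B\in\mathrm{FIN}^\infty:\exists n\ r_n(B)=a,\ B\le A\}$, $[n,A]=[r_n(A),A]$, $r_n[a,A]=\{r_n(B):B\in[a,A]\}$, $\mathrm{FIN}^{<\infty}\upharpoonright A=\{a:[a,A]\ne\emptyset\}$, $\mathrm{depth}_A(a)=\min\{n:a\le r_n(A)\}$, $\mathcal H\upharpoonright A=\{B\in\mathcal H:B\le A\}$. A coideal is $\mathcal H\subseteq\mathrm{FIN}^\infty$ such that: (a) $A\in\mathcal H$ and $A\triangle B$ finite (as sets of blocks) imply $B\in\mathcal H$; (b) $A\in\mathcal H$, $A\le B$ imply $B\in\mathcal H$; (c) for all $A\in\mathcal H$, $a\in\mathrm{FIN}^{<\infty}\upharpoonright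 A$: $[a,B]\ne\emptyset$ for all $B\in[\mathrm{depth}_A(a),A]\cap\mathcal H$, and if $B\in\mathcal H\upharpoonright A$, $[a,B]\ne\emptyset$, then some $A'\in[\mathrm{depth}_A(a),A]\cap\mathcal H$ has $\emptyset\ne[a,A']\subseteq[a,B]$; (d) for all $A\in\mathcal H$, $a\in\mathrm{FIN}^{<\infty}\upharpoonright A$, and every set $\mathcal O$ of block sequences of length $|a|+1$, some $B\in[\mathrm{depth}_A(a),A]\cap\mathcal H$ has $r_{|a|+1}[a,B]\subseteq\mathcal O$ or $r_{|a|+1}[a,B]\cap\mathcal O=\emptyset$. A coideal $\mathcal H$ is selective if for every $[a,A]\ne\emptyset$ with $A\in\mathcal H$ and every sequence $(A_n)_n\subseteq\mathcal H\upharpoonright A$ with $A_n\ge A_{n+1}$ and $[a,A_n]\ne\emptyset$, there is $B\in\mathcal H\cap[a,A]$ such that for every $b\in\mathrm{FIN}^{<\infty}\upharpoonright B$ with $\mathrm{depth}_A(b)=n$, $[b,B]\subseteq[b,A_n]$. A family $\mathcal H\subseteq\mathrm{FIN}^\infty$ is Matet-adequate if (1) it is closed under finite changes, (2) $A\in\mathcal H$, $A\le B$ imply $B\in\mathcal H$, (3) $(\mathcal H,\le^* )$ is $\sigma$-closed (every $\le^*$-decreasing sequence in $\mathcal H$ has a $\le^*$-lower bound in $\mathcal H$), (4) if $A\in\mathcal H$ and $FU(A)$ is partitioned into two pieces then some $B\le A$ in $\mathcal H$ has $FU(B)$ contained in one piece.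
   Formalization: In ''selective'', the clause [b,B] ⊆ [b,A_n] is read as: every member of [b,B] has all its blocks after the stem b in [A_n] (b itself need not be ≤ A_n). Read literally, no nonempty family closed under finite changes is selective, although FIN^∞ is Matet-adequate. *)

(* Defs.v *)
From HB Require Import structures.
From mathcomp Require Import all_boot finmap.
From mathcomp Require Import boolp classical_sets cardinality.

Set Implicit Arguments.
Unset Strict Implicit.
Unset Printing Implicit Defensive.

Local Open Scope classical_set_scope.

Record FIN := MkFIN { FINval :> {fset nat}; FIN_neq0 : FINval != fset0 }.
HB.instance Definition _ := [isSub for FINval].
HB.instance Definition _ := [Choice of FIN by <:].

Definition fsmax (s : {fset nat}) : nat := \max_(i <- s) i.

(* The neutral element [fsmax s] makes this the minimum when [s] is nonempty. *)
Definition fsmin (s : {fset nat}) : nat := \big[minn/fsmax s]_(i <- s) i.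

Definition block_lt (s t : FIN) : bool := fsmax s < fsmin t.

Record FINinf := MkFINinf {
  block :> nat -> FIN;
  block_ltS : forall n, block_lt (block n) (block n.+1) }.

Definition FINfin : set (seq FIN) := [set a | sorted block_lt a].

Definition FU (X : set FIN) : set FIN :=
  [set s | exists2 t : seq FIN, t != [::] /\ [set` t] `<=` X &
           FINval s = \big[fsetU/fset0]_(x <- t) FINval x].

(* The relations <= and <=^* between block sequences, finite or infinite, are
   relations between their sets of blocks: [range A] for [A : FINinf] and
   [[set` a]] for [a : seq FIN]. *)
Definition block_le (X Y : set FIN) : Prop := X `<=` FU Y.

Definition block_le_ae (X Y : set FIN) : Prop := finite_set (X `\` FU Y).

Definition le_inf (A B : FINinf) : Prop := block_le (range A) (range B).

Definition le_ae (A B : FINinf) : Prop := block_le_ae (range A) (range B).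

Definition fin_change (A B : FINinf) : Prop :=
  finite_set (range A `+` range B).

Definition r (n : nat) (A : FINinf) : seq FIN := mkseq A n.

Definition basic (a : seq FIN) (A : FINinf) : set FINinf :=
  [set B | (exists n, r n B = a) /\ le_inf B A].

Definition nbasic (n : nat) (A : FINinf) : set FINinf := basic (r n A) A.

Definition rbasic (n : nat) (a : seq FIN) (A : FINinf) : set (seq FIN) :=
  r n @` basic a A.

Definition FINfin_restr (A : FINinf) : set (seq FIN) :=
  [set a | FINfin a /\ basic a A !=set0].

(* The default value 0 is used only if no [r n A] is above [a], which cannot
   happen when [a] is in [FINfin_restr A]. *)
Definition depth (A : FINinf) (a : seq FIN) : nat :=
  xget 0 [set n | block_le [set` a] [set` r n A] /\
                  forall m, block_le [set` a] [set` r m A] -> n <= m].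

Record coideal (H : set FINinf) : Prop := Coideal {
  coideal_fin : forall A B, H A -> fin_change A B -> H B;
  coideal_up : forall A B, H A -> le_inf A B -> H B;
  coideal_amalg : forall A a, H A -> FINfin_restr A a ->
    (forall B, nbasic (depth A a) A B -> H B -> basic a B !=set0) /\
    (forall B, H B -> le_inf B A -> basic a B !=set0 ->
      exists A', [/\ nbasic (depth A a) A A', H A',
                     basic a A' !=set0 & basic a A' `<=` basic a B]);
  coideal_pigeonhole : forall A a (O : set (seq FIN)),
    H A -> FINfin_restr A a ->
    (forall b, O b -> FINfin b /\ size b = (size a).+1) ->
    exists B, [/\ nbasic (depth A a) A B, H B &
      rbasic (size a).+1 a B `<=` O \/ rbasic (size a).+1 a B `&` O = set0] }.

(* [basic_after b X] is the neighbourhood [b, X] in the convention in which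
   only the blocks following the stem [b] have to be generated by [X]. It is
   [basic b X] as soon as [b] is below [X] (lemma [basic_afterE]). The
   difference matters in [selective], where [b] need not be below [As n]:
   take the stem [::] and let [As n] be [A] with its first n blocks removed.
   The first block of [B] has some depth n > 0 in [A] and is disjoint from all
   of [As n], so that [basic b (As n)] is empty; hence no nonempty family that
   is closed under finite changes could satisfy the condition with [basic]. *)
Definition basic_after (b : seq FIN) (X : FINinf) : set FINinf :=
  [set C | (exists n, r n C = b) /\
           block_le [set C k | k in [set k | size b <= k]] (range X)].

Lemma basic_afterE (b : seq FIN) (X : FINinf) :
  block_le [set` b] (range X) -> basic_after b X = basic b X.
Proof.
move=> bX; apply/seteqP; split=> C [[n rC] CX]; split; try by exists n.
- move: rC bX CX => <- bX CX _ [k _ <-].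
  have [nk|kn] := leqP n k; first by apply: CX; exists k; rewrite //= size_mkseq.
  by apply: bX; rewrite /= -(nth_mkseq (C 0) C kn) mem_nth // size_mkseq.
- by move=> _ [k _ <-]; apply: CX; exists k.
Qed.

Definition selective (H : set FINinf) : Prop :=
  forall (a : seq FIN) (A : FINinf) (As : nat -> FINinf),
    FINfin a -> basic a A !=set0 -> H A ->
    (forall n, H (As n) /\ le_inf (As n) A) ->
    (forall n, le_inf (As n.+1) (As n)) ->
    (forall n, basic a (As n) !=set0) ->
    exists B, [/\ H B, basic a A B &
      forall b n, FINfin_restr B b -> depth A b = n ->
        basic b B `<=` basic_after b (As n)].

Definition selective_coideal (H : set FINinf) : Prop :=
  coideal H /\ selective H.

Record Matet_adequate (H : set FINinf) : Prop := MatetAdequate {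
  Matet_fin : forall A B, H A -> fin_change A B -> H B;
  Matet_up : forall A B, H A -> le_inf A B -> H B;
  Matet_sigma_closed : forall As : nat -> FINinf,
    (forall n, H (As n)) -> (forall n, le_ae (As n.+1) (As n)) ->
    exists B, H B /\ forall n, le_ae B (As n);
  Matet_partition : forall A (P Q : set FIN),
    H A -> P `|` Q = FU (range A) -> P `&` Q = set0 ->
    exists B, [/\ H B, le_inf B A & FU (range B) `<=` P \/ FU (range B) `<=` Q] }.

(* Main.v *)
(** From Matet-adequate to selective: amalgamation and pigeonhole follow by
    replacing the part of [A] past [depth A a] by a tail of a suitable member of
    the family. For selectivity, take a pseudo-intersection of the sequence and
    thin it, by a single application of the partition property, so that its gaps
    outgrow the rate at which it is eventually below each term. Conversely, the
    partition property is the pigeonhole for the empty stem, and sigma-closure is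
    selectivity applied to a [<=]-decreasing sequence of tails. *)
Require Import Defs.
From mathcomp Require Import all_boot finmap.
From mathcomp Require Import boolp classical_sets cardinality.
From mathcomp Require Import zify.

Set Implicit Arguments.
Unset Strict Implicit.
Unset Printing Implicit Defensive.

Local Open Scope classical_set_scope.

(** * Extrema of blocks and the block order *)

Lemma leq_fsmax (s : {fset nat}) x : x \in s -> x <= fsmax s.
Proof. by move=> xs; exact: (@leq_bigmax_seq _ (s : seq nat) xpredT id). Qed.

Lemma fsmin_leq (s : {fset nat}) x : x \in s -> fsmin s <= x.
Proof.
rewrite /fsmin => xs; have : x \in (s : seq nat) by [].
elim: (s : seq nat) => // y l IH; rewrite inE big_cons => /orP[/eqP <-|/IH].
  exact: geq_minl.
exact/leq_trans/geq_minr.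
Qed.

Lemma fsmax_in (s : FIN) : fsmax s \in FINval s.
Proof.
have /fset0Pn[x xs] := FIN_neq0 s.
(* The default 0 of the maximum need not lie in [s], so the induction only asks for an element of
   [s] above the maximum. *)
have : exists2 y, y \in FINval s & fsmax s <= y.
  rewrite /fsmax; have sub : {subset (FINval s : seq nat) <= FINval s} by [].
  elim: (FINval s : seq nat) sub => [|y l IH] sub.
    by exists x; rewrite // big_nil.
  have [|z zs lz] := IH; first by move=> z zl; apply: sub; rewrite inE zl orbT.
  rewrite big_cons; have [yz|zy] := leqP y z.
    by exists z; rewrite // geq_max yz.
  exists y; first by apply: sub; rewrite mem_head.
  by rewrite geq_max leqnn (leq_trans lz (ltnW zy)).
case=> y ys sy; suff -> : fsmax s = y by [].
by apply/eqP; rewrite eqn_leq sy leq_fsmax.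
Qed.

(** The induction can stop at the default value because [fsmax s] is itself in [s]. *)
Lemma fsmin_in (s : FIN) : fsmin s \in FINval s.
Proof.
rewrite /fsmin; have sub : {subset (FINval s : seq nat) <= FINval s} by [].
elim: (FINval s : seq nat) sub => [|y l IH] sub.
  by rewrite big_nil fsmax_in.
rewrite big_cons /minn; case: ifP => _; first by apply: sub; rewrite mem_head.
by apply: IH => z zl; apply: sub; rewrite inE zl orbT.
Qed.

Lemma fsmin_leq_fsmax (s : FIN) : fsmin s <= fsmax s.
Proof. exact/leq_fsmax/fsmin_in. Qed.

Lemma fsmax_sub (s t : FIN) : (FINval s `<=` FINval t)%fset -> fsmax s <= fsmax t.
Proof. by move=> /fsubsetP st; apply/leq_fsmax/st/fsmax_in. Qed.

Lemma fsmin_sub (s t : FIN) : (FINval s `<=` FINval t)%fset -> fsmin t <= fsmin s.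
Proof. by move=> /fsubsetP st; apply/fsmin_leq/st/fsmin_in. Qed.

Lemma block_lt_trans : transitive block_lt.
Proof.
move=> t s u; rewrite /block_lt => st tu.
exact: leq_trans st (leq_trans (fsmin_leq_fsmax t) (ltnW tu)).
Qed.

Lemma block_lt_mono (A : FINinf) i j : i < j -> block_lt (A i) (A j).
Proof.
elim: j => // j IH; rewrite ltnS leq_eqVlt => /orP[/eqP->|/IH ij].
  exact: block_ltS.
exact: block_lt_trans ij (block_ltS A j).
Qed.

Lemma fsmax_mono (A : FINinf) i j : i <= j -> fsmax (A i) <= fsmax (A j).
Proof.
rewrite leq_eqVlt => /orP[/eqP->//|/(block_lt_mono A)]; rewrite /block_lt => ij.
exact: leq_trans (ltnW ij) (fsmin_leq_fsmax _).
Qed.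

Lemma block_lt_ltn (A : FINinf) i j : block_lt (A i) (A j) -> i < j.
Proof.
rewrite /block_lt; case: (ltnP i j) => // /(fsmax_mono A) ji ij.
by have := leq_trans ij (leq_trans (fsmin_leq_fsmax _) ji); rewrite ltnn.
Qed.

(** The minima increase strictly. This is what turns bounds on indices into bounds on elements. *)
Lemma leq_fsmin_block (A : FINinf) n : n <= fsmin (A n).
Proof.
elim: n => // n IH; apply: leq_trans (block_ltS A n).
by rewrite ltnS (leq_trans IH) ?fsmin_leq_fsmax.
Qed.

(** * Finite unions *)

Lemma FU_id (X : set FIN) : X `<=` FU X.
Proof.
move=> x Xx; exists [:: x]; last by rewrite big_seq1.
by split=> // y; rewrite /= inE => /eqP->.
Qed.

Lemma FU_flatten (Y : set FIN) (t : seq FIN) :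
  t != [::] -> [set` t] `<=` FU Y ->
  exists2 u : seq FIN, u != [::] /\ [set` u] `<=` Y &
    \big[fsetU/fset0]_(x <- t) FINval x = \big[fsetU/fset0]_(x <- u) FINval x.
Proof.
elim: t => // x t IH _ sub.
have [u [u0 uY] xu] := sub x (mem_head x t).
have [t0|/IH[|v [v0 vY] tv]] := eqVneq t [::].
- by exists u; rewrite // t0 big_seq1.
- by move=> y yt; apply: sub; rewrite /= inE yt orbT.
exists (u ++ v); last by rewrite big_cons big_cat xu tv.
split; first by case: (u) u0.
by move=> y /=; rewrite mem_cat => /orP[/uY|/vY].
Qed.

(** A local form of monotonicity: constituents of [s] are subsets of [s], so bounds on the extrema
    of [s] rule out blocks of [X] that are too early or too late. *)
Lemma FU_constituents (X Y : set FIN) (s : FIN) :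
  FU X s -> (forall x, X x -> (FINval x `<=` FINval s)%fset -> FU Y x) ->
  FU Y s.
Proof.
move=> [t [t0 tX] st] XY.
have [|u uY tu] := @FU_flatten Y t t0; last by exists u; rewrite // st.
move=> x xt; apply: XY; first exact: tX.
by rewrite st (big_rem _ xt) /= fsubsetUl.
Qed.

Lemma FU_mono (X Y : set FIN) : X `<=` FU Y -> FU X `<=` FU Y.
Proof. by move=> XY s /FU_constituents; apply=> x /XY. Qed.

Lemma FU_mem (X : set FIN) (s : FIN) n : FU X s -> n \in FINval s ->
  exists x, [/\ X x, (FINval x `<=` FINval s)%fset & n \in FINval x].
Proof.
move=> [t [_ tX] st]; rewrite st => ns.
have : exists2 x, x \in t & n \in FINval x.
  elim: t {st tX} ns => [|x t IH]; first by rewrite big_nil in_fset0.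
  rewrite big_cons in_fsetU => /orP[nx|/IH[y yt ny]].
    by exists x; rewrite ?mem_head.
  by exists y; rewrite // inE yt orbT.
case=> x xt nx; exists x; split=> //; first exact: tX.
by rewrite (big_rem _ xt) /= fsubsetUl.
Qed.

Definition finU (s t : FIN) : FIN.
Proof.
exists (FINval s `|` FINval t)%fset.
by rewrite fsetU_eq0 negb_and FIN_neq0.
Defined.

Lemma FU_finU (X : set FIN) s t : FU X s -> FU X t -> FU X (finU s t).
Proof.
move=> Xs Xt; apply: (@FU_mono [set` [:: s; t]]).
  by move=> x /=; rewrite !inE => /orP[/eqP->|/eqP->].
by exists [:: s; t]; [split | rewrite !big_cons big_nil fsetU0].
Qed.

(** * Initial segments and almost inclusion *)

Lemma mem_r (A : FINinf) n x : x \in r n A -> exists2 i, i < n & x = A i.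
Proof. by case/mapP=> i; rewrite mem_iota /= => ni ->; exists i. Qed.

Lemma r_mem (A : FINinf) n i : i < n -> A i \in r n A.
Proof. by move=> ni; apply: map_f; rewrite mem_iota. Qed.

Lemma r_size (A : FINinf) n a : r n A = a -> n = size a.
Proof. by move<-; rewrite size_mkseq. Qed.

Lemma FINfin_r (A : FINinf) n : FINfin (r n A).
Proof.
rewrite /FINfin /= sorted_map.
apply/(sub_sorted _ (iota_ltn_sorted 0 n)) => i j; exact: block_lt_mono.
Qed.

Lemma le_inf_chain (As : nat -> FINinf) :
  (forall n, le_inf (As n.+1) (As n)) ->
  forall m n, m <= n -> FU (range (As n)) `<=` FU (range (As m)).
Proof.
move=> dec m n /subnKC <-; elim: (n - m) => [|k IH]; first by rewrite addn0.
by rewrite addnS; apply: subset_trans IH; apply: FU_mono; exact: dec.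
Qed.

Lemma le_inf_ae (A B : FINinf) : le_inf A B -> le_ae A B.
Proof.
rewrite /le_inf /block_le -setD_eq0 /le_ae /block_le_ae => ->.
exact: finite_set0.
Qed.

(** The threshold bounds minima rather than indices, so that it still makes sense for sequences
    below [B]. *)
Lemma le_ae_bound (B A : FINinf) : le_ae B A ->
  exists N, forall k, N < fsmin (B k) -> FU (range A) (B k).
Proof.
move=> /finite_seqP[l El]; exists (\max_(x <- l) fsmin x) => k Nk.
apply: contrapT => nF.
have : [set` l] (B k) by rewrite -El; split; first by exists k.
move=> /= /(@leq_bigmax_seq _ l xpredT fsmin) /(_ isT).
by rewrite leqNgt Nk.
Qed.

Lemma fin_change_tails (A C : FINinf) n m :
  (forall k, C (n + k) = A (m + k)) -> fin_change A C.
Proof.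
move=> CA.
apply: (@sub_finite_set _ _ ((A @` `I_m) `|` (C @` `I_n))); last first.
  by rewrite finite_setU; split; apply: finite_image; apply: finite_II.
move=> x [] [[i _ <-]] nx; [left|right].
  exists i => //=; rewrite ltnNge; apply/negP => mi; apply: nx.
  by exists (n + (i - m)); rewrite // CA subnKC.
exists i => //=; rewrite ltnNge; apply/negP => ni; apply: nx.
by exists (m + (i - n)); rewrite // -CA subnKC.
Qed.

(** * Tails and grafting onto a finite stem *)

Definition drop_blocks (A : FINinf) (m : nat) : FINinf.
Proof.
exists (fun k => A (m + k)) => k; rewrite addnS; exact: block_ltS.
Defined.

Lemma fin_change_drop (A : FINinf) m : fin_change A (drop_blocks A m).
Proof. by apply: (@fin_change_tails _ _ 0 m) => k; rewrite add0n. Qed.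

Lemma le_ae_drop (B A : FINinf) m : le_ae B A ->
  exists m', le_inf (drop_blocks B m') (drop_blocks A m).
Proof.
(* Past [N] the blocks of [B] are generated by [A]; past [fsmax (A m)] their constituents in [A]
   have index above [m]. *)
move=> /le_ae_bound[N NP]; exists (maxn N (fsmax (A m))).+1 => _ [k _ <-] /=.
set j := _ + k; have := leq_fsmin_block B j.
have jN : maxn N (fsmax (A m)) < j by rewrite /j addSn ltnS leq_addr.
move=> /(leq_trans jN); rewrite gtn_max => /andP[/NP FB Aj].
apply: (FU_constituents FB) => _ [i _ <-] /fsmin_sub Bi.
have /block_lt_ltn /ltnW mi : block_lt (A m) (A i) := leq_trans Aj Bi.
by apply: FU_id; exists (i - m); rewrite //= subnKC.
Qed.

Lemma graft (a : seq FIN) (B : FINinf) (N : nat) : FINfin a ->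
  exists C, [/\ r (size a) C = a, fin_change B C &
    range C `<=` [set` a] `|` [set B k | k in [set k | N < fsmin (B k)]]].
Proof.
move=> sa.
(* From index [m] on, the blocks of [B] lie beyond [N] and beyond all of [a]. *)
pose m := (maxn N (\max_(x <- a) fsmax x)).+1.
have mN k : N < fsmin (B (m + k)).
  apply: leq_trans (leq_fsmin_block B (m + k)).
  by rewrite /m addSn ltnS; apply: leq_trans (leq_maxl N _) (leq_addr _ _).
have am x : x \in a -> block_lt x (B m).
  move=> /(@leq_bigmax_seq _ a xpredT fsmax) /(_ isT).
  move=> xm; apply: leq_trans (leq_fsmin_block B m).
  by rewrite /m ltnS leq_max xm orbT.
pose c k := if k < size a then nth (B 0) a k else B (m + (k - size a)).
have cS k : block_lt (c k) (c k.+1).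
  rewrite /c; have [ka|ak] := ltnP k.+1 (size a).
    rewrite (ltnW ka); move/(sortedP (B 0)): sa; exact.
  have [ka|ak'] := ltnP k (size a).
    have -> : k.+1 - size a = 0 by lia.
    by rewrite addn0; apply/am/mem_nth.
  by rewrite subSn // addnS; exact: block_ltS.
exists (MkFINinf cS); split.
- apply: (@eq_from_nth _ (B 0)); first by rewrite size_mkseq.
  move=> i; rewrite size_mkseq => ia.
  by rewrite nth_mkseq //= /c ia.
- apply: (@fin_change_tails _ _ (size a) m) => k /=.
  by rewrite /c ltnNge leq_addr /= addKn.
move=> _ [k _ <-] /=; rewrite /c; case: ifP => ka; first by left; exact: mem_nth.
by right; exists (m + (k - size a)); rewrite /=.
Qed.

Lemma range_graft (a : seq FIN) (C : FINinf) x :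
  r (size a) C = a -> x \in a -> range C x.
Proof. by move=> rC; rewrite -{1}rC => /mem_r[i _ ->]; exists i. Qed.

(** * Neighbourhoods and depth *)

Lemma basic_block_le (a : seq FIN) (A : FINinf) :
  basic a A !=set0 -> block_le [set` a] (range A).
Proof. by case=> B [[n <-] BA] x /mem_r[i _ ->]; apply: BA; exists i. Qed.

Lemma basic_neq0 a (A : FINinf) :
  FINfin a -> block_le [set` a] (range A) -> basic a A !=set0.
Proof.
move=> sa aA; have [C [rC _ CA]] := graft A 0 sa.
exists C; split; first by exists (size a).
by move=> x /CA[/aA//|[k _ <-]]; apply: FU_id; exists k.
Qed.

Lemma basic_after_stem (a : seq FIN) (X C : FINinf) x k :
  basic a X C -> x \in a -> size a <= k -> block_lt x (C k).
Proof.
move=> [[n rC] _]; rewrite -(r_size rC) -rC => /mem_r[i ni ->] nk.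
exact/block_lt_mono/(leq_trans ni).
Qed.

Lemma basic_rS (a : seq FIN) (X C : FINinf) :
  basic a X C -> r (size a).+1 C = rcons a (C (size a)).
Proof.
move=> [[n rC] _]; rewrite -(r_size rC) -[in RHS]rC /r /mkseq.
by rewrite -addn1 iotaD map_cat -cats1.
Qed.

Lemma block_le_r (a : seq FIN) (A : FINinf) m :
  block_le [set` a] (range A) -> (forall x, x \in a -> fsmax x < fsmin (A m)) ->
  block_le [set` a] [set` r m A].
Proof.
move=> aA am x xa; apply: (FU_constituents (aA x xa)) => _ [i _ <-] /fsmax_sub ix.
apply/FU_id/r_mem/(@block_lt_ltn A)/(leq_ltn_trans ix)/am/xa.
Qed.

Lemma depthP (a : seq FIN) (A : FINinf) : block_le [set` a] (range A) ->
  block_le [set` a] [set` r (depth A a) A] /\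
  forall m, block_le [set` a] [set` r m A] -> depth A a <= m.
Proof.
move=> aA; rewrite /depth; case: xgetP => [n _ [] //|/= none].
pose P m := `[< block_le [set` a] [set` r m A] >].
have exP : exists m, P m.
  exists (\max_(x <- a) fsmax x).+1; apply/asboolP/block_le_r => // x.
  move=> /(@leq_bigmax_seq _ a xpredT fsmax) /(_ isT) xm.
  exact: leq_trans (leq_fsmin_block A _).
case: (ex_minnP exP) => m /asboolP am mmin.
by case: (none m); split=> // k /asboolP; exact: mmin.
Qed.

Lemma depth_le (a : seq FIN) (A : FINinf) m :
  block_le [set` a] (range A) -> (forall x, x \in a -> fsmax x < fsmin (A m)) ->
  depth A a <= m.
Proof. by move=> aA am; have [_ ->] := depthP aA; last exact: block_le_r. Qed.

(** [A'] is the first [depth A a] blocks of [A] followed by a tail of [B]. A block after the stem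
    [a] cannot contain [A i] with [i < depth A a]: all of [a] would lie before [A i], which forces
    [depth A a <= i]. *)
Lemma graft_depth (a : seq FIN) (A B : FINinf) :
  block_le [set` a] (range A) -> le_inf B A ->
  exists A', [/\ nbasic (depth A a) A A', fin_change B A',
    block_le [set` a] (range A') &
    forall C k, basic a A' C -> size a <= k -> FU (range B) (C k)].
Proof.
move=> aA BA; have [ad dmin] := depthP aA.
have [A' [rA' BA' rg]] := graft B 0 (@FINfin_r A (depth A a)).
exists A'; split=> //.
- split; first by rewrite /r size_mkseq in rA'; exists (depth A a).
  move=> x /rg[/mem_r[i _ ->]|[k _ <-]]; first by apply: FU_id; exists i.
  by apply: BA; exists k.
- move=> x /ad; apply: FU_mono => y yr; apply: FU_id.
  exact: range_graft rA' yr.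
move=> C k CA' ak; have [_ /(_ (C k)) FC] := CA'.
apply: FU_constituents (FC _) _; first by exists k.
move=> y /rg[/mem_r[i id ->]|[j _ <-] _]; last by apply: FU_id; exists j.
move=> /fsmin_sub Ci.
suff : depth A a <= i by rewrite leqNgt id.
apply: depth_le => // x xa; apply: leq_trans Ci.
exact: basic_after_stem CA' xa ak.
Qed.

(** * Matet-adequate families are coideals *)

Lemma Matet_coideal (H : set FINinf) : Matet_adequate H -> coideal H.
Proof.
move=> HM; split; [exact: Matet_fin | exact: Matet_up | |].
- move=> A a HA [sa /basic_block_le aA]; split.
    move=> B [[n rB] _] _; apply: basic_neq0 => // x xa.
    have [/(_ x xa) + _] := depthP aA; apply: FU_mono => y /=.
    by rewrite -rB => /mem_r[i _ ->]; apply: FU_id; exists i.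
  move=> B HB BA /basic_block_le aB.
  have [A' [AA' BA' aA' past]] := graft_depth aA BA.
  exists A'; split=> //; [exact: Matet_fin HB BA' | exact: basic_neq0 |].
  move=> C CA'; have [[n rC] _] := CA'; split; first by exists n.
  move=> _ [k _ <-]; have [ak|ka] := leqP (size a) k; first exact: past CA' ak.
  by apply: aB => /=; rewrite -rC r_mem // (r_size rC).
move=> A a O HA [sa /basic_block_le aA] _.
(* A one-block extension of [a] is determined by its last block, so [O] induces a partition of
   [FU (range A)]. *)
pose P := [set s | FU (range A) s /\ O (rcons a s)].
have [||B [HB BA hom]] := @Matet_partition H HM A P (FU (range A) `\` P) HA.
- by rewrite setDUK // => s [].
- by rewrite setDIK.
have [A' [AA' BA' aA' past]] := graft_depth aA BA.
exists A'; split=> //; first exact: Matet_fin HB BA'.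
case: hom => hom; [left|right].
  move=> _ [C CA' <-]; rewrite (basic_rS CA').
  by have /hom[] := past C _ CA' (leqnn _).
apply/seteqP; split=> // _ [[C CA' <-]]; rewrite (basic_rS CA') => OC.
have /hom[FC] := past C _ CA' (leqnn _); exact.
Qed.

(** * Thinning by the parity of short gaps *)

Definition close_elt (g : nat -> nat) (s : {fset nat}) (x : nat) : bool :=
  has (fun y => x < y <= g x) s.

(** An element is close exactly when its successor in [s] is at most its image under [g], so this is
    the parity of the number of short gaps between consecutive elements. *)
Definition gap_parity (g : nat -> nat) (s : {fset nat}) : bool :=
  odd (count (close_elt g s) s).

(** Joining [s] and [t] creates just one new gap, from [fsmax s] to [fsmin t]; all other elements
    keep their status. *)
Lemma gap_parityU g (s t : FIN) : block_lt s t ->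
  gap_parity g (finU s t) =
  gap_parity g s (+) gap_parity g t (+) (fsmin t <= g (fsmax s)).
Proof.
rewrite /block_lt => st; pose b := fsmin t <= g (fsmax s).
have stlt x y : x \in FINval s -> y \in FINval t -> x < y.
  by move=> /leq_fsmax xs /fsmin_leq ty; apply: leq_ltn_trans xs (leq_trans st ty).
have closeU x : close_elt g (finU s t) x = close_elt g s x || close_elt g t x.
  apply/hasP/orP => [[y]|[] /hasP[y ys ?]].
  - by rewrite in_fsetU => /orP[ys|yt] xy; [left|right]; apply/hasP; exists y.
  - by exists y; rewrite // in_fsetU ys.
  - by exists y; rewrite // in_fsetU ys orbT.
have perm : perm_eq (finU s t : {fset nat}) (FINval s ++ FINval t).
  apply: uniq_perm; rewrite ?fset_uniq // ?cat_uniq ?fset_uniq /= ?andbT.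
    apply/hasPn => x xt; apply/negP => /= xs.
    by have := stlt _ _ xs xt; rewrite ltnn.
  by move=> x; rewrite mem_cat /= in_fsetU.
have Et : count (close_elt g (finU s t)) (FINval t) =
          count (close_elt g t) (FINval t).
  apply: eq_in_count => x xt; rewrite closeU orbC; case: (close_elt g t x) => //=.
  apply/hasPn => y ys; have := stlt _ _ ys xt; lia.
have Es : count (close_elt g (finU s t)) (FINval s) =
          count (close_elt g s) (FINval s) + b.
  have -> : b = count (fun x => (x == fsmax s) && b) (FINval s) :> nat.
    case: b; last by under eq_count do rewrite andbF; rewrite count_pred0.
    by under eq_count do rewrite andbT; rewrite (count_uniq_mem _ (fset_uniq _)) fsmax_in.
  rewrite -count_predUI (@eq_in_count _ (predI _ _) pred0) ?count_pred0 ?addn0.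
    apply: eq_in_count => x xs /=; rewrite closeU.
    have [->|xm] := eqVneq x (fsmax s).
      congr (_ || _); apply/hasP/idP => [[y yt /andP[_]]|bt].
        exact/leq_trans/fsmin_leq.
      by exists (fsmin t); rewrite ?fsmin_in // st.
    rewrite orbF; case Cs: (close_elt g s x) => //=.
    (* If [g x] reached an element of [t], it would also reach [fsmax s], and [x] would already be
       close in [s]. *)
    apply/hasPn => y yt; apply/negP => /andP[_ yg].
    move/negP: Cs => Cs; apply: Cs; apply/hasP; exists (fsmax s); first exact: fsmax_in.
    by rewrite ltn_neqAle xm leq_fsmax // (leq_trans _ yg) // ltnW // stlt // fsmax_in.
  move=> x xs /=; apply/negP => /andP[/hasP[y ys] + /andP[/eqP xm _]].
  by have := leq_fsmax ys; lia.
rewrite /gap_parity (permP perm) count_cat Es Et !oddD oddb.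
by rewrite -!addbA; congr (_ (+) _); rewrite addbC.
Qed.

(* Colour [s] by the parity of its number of gaps that are short with respect
   to [g]. On a homogeneous [B] of colour [e], additivity gives
   [e = e (+) e (+) short gap], so that the gaps between blocks of [B] are all
   short or all long; they are long because [B] is infinite. *)
Lemma Matet_sparse (H : set FINinf) (A : FINinf) (g : nat -> nat) :
  Matet_adequate H -> H A ->
  exists B, [/\ H B, le_inf B A &
    forall i j, i < j -> g (fsmax (B i)) < fsmin (B j)].
Proof.
move=> HM HA; pose P := [set s : FIN | FU (range A) s /\ gap_parity g s].
have [||B [HB BA hom]] := @Matet_partition H HM A P (FU (range A) `\` P) HA.
- by rewrite setDUK // => s [].
- by rewrite setDIK.
exists B; split=> // i j ij.
have FB k : FU (range B) (B k) by apply: FU_id; exists k.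
have [e col] : exists e, forall s : FIN, FU (range B) s -> gap_parity g s = e.
  case: hom => hom; [exists true|exists false] => s /hom[] //.
  by move=> FA nP; apply/negP => ps; apply: nP.
have gap k : i < k -> (fsmin (B k) <= g (fsmax (B i))) = e.
  move=> ik; have := gap_parityU g (block_lt_mono B ik).
  by rewrite !col //; [case: e {col}; case: leqP | exact: FU_finU].
rewrite ltnNge gap //; apply/negP => e1.
have := gap (maxn i (g (fsmax (B i)))).+1.
rewrite e1 ltnS leq_maxl => /(_ isT) /(leq_trans (leq_fsmin_block B _)).
by rewrite gtn_max ltnn andbF.
Qed.

(** * Selectivity of Matet-adequate families *)

Lemma Matet_selective (H : set FINinf) : Matet_adequate H -> selective H.
Proof.
move=> HM a A As sa aA HA HAs dec aAs.
have [|n|B0 [HB0 B0As]] := @Matet_sigma_closed H HM As.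
- by move=> n; have [] := HAs n.
- exact/le_inf_ae/dec.
(* The shift to [n.+1] anticipates that a stem [b] with maximum [m] has depth at most [m.+1] in
   [A]. *)
have [g gP] := choice (fun n => le_ae_bound (B0As n.+1)).
have [B1 [HB1 B10 B1g]] := Matet_sparse g HM HB0.
have FB1 n j : g n < fsmin (B1 j) -> FU (range (As n.+1)) (B1 j).
  move=> gj; apply: (FU_constituents (B10 (B1 j) _)); first by exists j.
  by move=> _ [k _ <-] /fsmin_sub kj; apply/gP/(leq_trans gj).
(* [g 0] serves the empty stem and [B <= A]; the other terms serve stems whose last element comes
   from a block of [a], where the sparseness of [B1] says nothing. *)
pose N := maxn (g 0) (\max_(x <- a) g (fsmax x)).
have aN x : x \in a -> g (fsmax x) <= N.
  move=> xa; rewrite leq_max.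
  by rewrite (@leq_bigmax_seq _ a xpredT (fun y : FIN => g (fsmax y)) x xa isT) orbT.
have [B [rB B1B rg]] := graft B1 N sa.
have BA : le_inf B A.
  move=> x /rg[/(basic_block_le aA)//|[j /= Nj <-]].
  have [_ A1A] := HAs 1; apply: FU_mono A1A _ _; apply: FB1.
  by apply: leq_ltn_trans Nj; rewrite leq_maxl.
exists B; split; [exact: Matet_fin HB1 B1B | by split; first by exists (size a) |].
move=> b n0 [sb bB] <- C CbB; have [[n rC] CB] := CbB; split; first by exists n.
have bB' := basic_block_le bB.
have bA : block_le [set` b] (range A) by move=> x /bB'; exact: FU_mono.
move=> _ [k /= bk <-].
apply: (FU_constituents (CB (C k) _)); first by exists k.
move=> y /rg[ya _|[j /= Nj <-] /fsmin_sub Cj].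
  exact: (basic_block_le (aAs _) ya).
(* Then [B1 j] is generated by [As m.+1], hence by the earlier term [As (depth A b)]. *)
suff [m gm bm] : exists2 m, g m < fsmin (B1 j) & depth A b <= m.+1.
  exact: le_inf_chain dec _ _ bm _ (FB1 _ _ gm).
have [b0|b0] := posnP (size b).
  exists 0; first by apply: leq_ltn_trans Nj; rewrite leq_maxl.
  by apply: depth_le => // x; rewrite (size0nil b0).
have En := r_size rC; set x := C (size b).-1.
have xb : x \in b by rewrite -rC En r_mem // prednK.
exists (fsmax x); last first.
  apply: depth_le => // z; rewrite -[in X in X -> _]rC En => /mem_r[i ib ->].
  apply: leq_ltn_trans (leq_fsmin_block A _).
  by apply: fsmax_mono; rewrite -ltnS prednK.
(* The sparseness of [B1] controls [g] only at maxima of its blocks, so the maximum of [x] is traced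
   to the block [z] of [B] that contains it. *)
have [z [Bz zx xz]] := FU_mem (bB' x xb) (fsmax_in x).
have -> : fsmax x = fsmax z.
  by apply/eqP; rewrite eqn_leq (leq_fsmax xz) fsmax_sub.
have zlt : fsmax z < fsmin (B1 j).
  apply: leq_ltn_trans (fsmax_sub zx) _; apply: leq_trans Cj.
  exact: basic_after_stem CbB xb bk.
case: (rg _ Bz) zlt => [/aN za _|[i _ <-] /block_lt_ltn]; last exact: B1g.
exact: leq_ltn_trans Nj.
Qed.

(** * From selective coideals back to Matet-adequate families *)

Lemma selective_partition (H : set FINinf) : coideal H ->
  forall A (P Q : set FIN),
    H A -> P `|` Q = FU (range A) -> P `&` Q = set0 ->
    exists B, [/\ H B, le_inf B A & FU (range B) `<=` P \/ FU (range B) `<=` Q].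
Proof.
move=> Hc A P Q HA PQ _.
have A0 : FINfin_restr A [::] by split=> //; apply: basic_neq0.
have [|B [[_ BA] HB hom]] :=
  @coideal_pigeonhole H Hc A [::] [set [:: s] | s in P] HA A0.
  by move=> _ [s _ <-].
exists B; split=> //.
(* Every finite union from [B] is the first block of a sequence below [B], so homogeneity for the
   empty stem covers all of [FU (range B)]. *)
have rB s : FU (range B) s -> rbasic 1 [::] B [:: s].
  move=> Bs; have [C [rC _ CB]] := @graft [:: s] B 0 isT.
  exists C; last exact: rC.
  split; first by exists 0.
  by move=> x /CB[/=|[k _ <-]]; [rewrite inE => /eqP-> | apply: FU_id; exists k].
case: hom => hom; [left|right] => s Bs.
  by have [t Pt [<-]] := hom _ (rB s Bs).
have : (P `|` Q) s by rewrite PQ; apply: FU_mono Bs.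
case=> // Ps; suff : set0 [:: s] by [].
by rewrite -hom; split; [exact: rB | exists s].
Qed.

Lemma selective_sigma_closed (H : set FINinf) : selective_coideal H ->
  forall As : nat -> FINinf,
    (forall n, H (As n)) -> (forall n, le_ae (As n.+1) (As n)) ->
    exists B, H B /\ forall n, le_ae B (As n).
Proof.
move=> [Hc Hs] As HAs dec.
have [f fP] := choice (fun p : nat * nat => le_ae_drop p.2 (dec p.1)).
(* Each cut is chosen after the preceding one, so that the tails [Ds] decrease with no exceptional
   blocks. *)
pose m := fix m n := if n is k.+1 then f (k, m k) else 0.
pose Ds n := drop_blocks (As n) (m n).
have Ddec n : le_inf (Ds n.+1) (Ds n) := fP (n, m n).
have HD n : H (Ds n) := coideal_fin Hc (HAs n) (fin_change_drop (As n) (m n)).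
have basic0 X : basic [::] X !=set0 by apply: basic_neq0.
have [//|//|//|n|//|//|B [HB [_ BD] Bsel]] := Hs [::] (Ds 0) Ds.
  split=> // x xD.
  by apply: le_inf_chain Ddec _ _ (leq0n n) _ _; exact: FU_id.
exists B; split=> // n.
(* [B k] lies beyond [Ds 0 n], so the first [n] blocks of [Ds 0] cannot generate it; hence [b] has
   depth at least [n]. *)
pose k := (fsmax (Ds 0 n)).+1; pose b := r k.+1 B.
have bB : block_le [set` b] (range B).
  by move=> x /mem_r[i _ ->]; apply: FU_id; exists i.
have bD : block_le [set` b] (range (Ds 0)) by move=> x /bB; exact: FU_mono.
have nb : n <= depth (Ds 0) b.
  rewrite leqNgt; apply/negP => bn.
  have [/(_ (B k) (r_mem B (ltnSn k))) FBk _] := depthP bD.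
  have [_ [/mem_r[i ib ->] _ /leq_fsmax]] := FU_mem FBk (fsmax_in (B k)).
  apply/negP; rewrite -ltnNge.
  apply: leq_trans (fsmin_leq_fsmax _); apply: leq_trans (leq_fsmin_block B k).
  by rewrite ltnS fsmax_mono // ltnW // (leq_trans ib) // ltnW.
(* Selectivity is applied to [B] itself as a member of [basic b B]: its blocks after [b] are
   generated by [Ds n], which leaves at most [k.+1] exceptions. *)
have [_ CD] : basic_after b (Ds (depth (Ds 0) b)) B.
  apply: (Bsel b) => //.
    by split; [exact: FINfin_r | exact: basic_neq0 (@FINfin_r _ _) bB].
  by split; [exists k.+1 | move=> x; exact: FU_id].
apply: (@sub_finite_set _ _ (B @` `I_k.+1)); last exact/finite_image/finite_II.
move=> _ [[j _ <-] nF]; exists j => //=; rewrite ltnNge; apply/negP => kj.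
apply: nF; have : FU (range (Ds n)) (B j).
  apply: le_inf_chain Ddec _ _ nb _ _; apply: CD.
  by apply: imageP; rewrite /mkset size_mkseq.
by apply: FU_mono => _ [i _ <-]; apply: FU_id; exists (m n + i).
Qed.

Theorem theorem4p11 :
  (forall H : set FINinf, Matet_adequate H -> selective_coideal H) /\
  (forall H : set FINinf, Matet_adequate H <-> selective_coideal H).
Proof.
have M2S (H : set FINinf) : Matet_adequate H -> selective_coideal H.
  by move=> HM; split; [exact: Matet_coideal | exact: Matet_selective].
split=> // H; split=> [|HS]; first exact: M2S.
have [Hc _] := HS; split.
- exact: coideal_fin.
- exact: coideal_up.
- exact: selective_sigma_closed.
- exact: selective_partition.
Qed.
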